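(* Let $1\le k<n$ and $T\ge1$. Let $\mathcal{B}^n_{n-k}=\{w\in\mathbb{R}^n:\sum_iw_i=1,\ 0\le w_i\le\frac1{n-k}\}$. Run the following algorithm: start from $w_1\in\mathcal{B}^n_{n-k}$; at each $t$, write $w_t$ as a convex combination $\sum_jp_jr_j$ of corners $r_j$ of $\mathcal{B}^n_{n-k}$ (vectors with $n-k$ entries equal to $\frac1{n-k}$ and the rest $0$), sample $r=r_j$ with probability $p_j$, and select the subset $v_t=(n-k)r\in\{0,1\}^n$ of $n-k$ experts (so $\mathbb{E}[v_t]=(n-k)w_t$); then receive the loss vector $\ell_t\in[0,1]^n$ and update $$v'_{t+1,i}=\frac{w_{t,i}e^{-\eta\ell_{t,i}}}{\sum_jw_{t,j}e^{-\eta\ell_{t,j}}},\quad \hat w_{t+1,i}=\frac\alpha n+(1-\alpha)v'_{t+1,i},\quad w_{t+1}=\operatorname{argmin}_{w\in\mathcal{B}^n_{n-k}}d(w,\hat w_{t+1}),$$ where $d(q,w)=\sum_iq_i\ln(q_i/w_i)$. Suppose $L>0$ satisfies $\min_{q\in\mathcal{B}^n_{n-k}}\sum_{t=r}^s(n-k)q^\top\ell_t\le L$ for all $1\le r\le s\le T$, and set $\alpha=\frac1{T(n-k)+1}$, $D=(n-k)\ln(n(1+(n-k)T))+1$, $\eta=\ln(1+\sqrt{2D/L})$. Then $$\mathcal{R}_a^{\mathrm{subexp}}:=\max_{[r,s]\subset[1,T]}\Big\{\sum_{t=r}^s\mathbb{E}[v_t^\top\ell_t]-\min_{u\in\mathcal{S}_{\mathrm{vec}}}\sum_{t=r}^su^\top\ell_t\Big\}\le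 O(\sqrt{2LD}+D),$$ where $\mathcal{S}_{\mathrm{vec}}$ is the set of vectors in $\{0,1\}^n$ with exactly $n-k$ entries equal to $1$.
   Context: Here $\mathbb{E}[v_t^\top\ell_t]=(n-k)w_t^\top\ell_t$, and $\min_{u\in\mathcal{S}_{\mathrm{vec}}}\sum_t u^\top\ell_t=\min_{q\in\mathcal{B}^n_{n-k}}\sum_t(n-k)q^\top\ell_t$. $O(\cdot)$ hides an absolute constant. *)

(* Defs.v *)
From HB Require Import structures.
From mathcomp Require Import all_boot all_order all_algebra.
From mathcomp Require Import all_classical all_reals all_analysis.
Unset Implicit Arguments. Unset Printing Implicit Defensive.
Import Order.TTheory GRing.Theory Num.Theory.
Local Open Scope classical_set_scope.
Local Open Scope ring_scope.

Section Defs.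
Variable R : realType.

Definition dotv (n : nat) (a b : 'I_n -> R) : R := \sum_i a i * b i.

Definition capped_simplex (n k : nat) (w : 'I_n -> R) : Prop :=
  \sum_i w i = 1 /\ forall i, 0 <= w i <= ((n - k)%:R)^-1.

Definition is_corner (n k : nat) (r : 'I_n -> R) : Prop :=
  (forall i, r i = 0 \/ r i = ((n - k)%:R)^-1) /\
  #|[set i | r i != 0]| = (n - k)%N.

Definition S_vec (n k : nat) (u : 'I_n -> R) : Prop :=
  (forall i, u i = 0 \/ u i = 1) /\ #|[set i | u i == 1]| = (n - k)%N.

Definition KLd (n : nat) (q w : 'I_n -> R) : R := \sum_i q i * ln (q i / w i).

Definition is_KL_proj (n k : nat) (w what : 'I_n -> R) : Prop :=
  capped_simplex n k w /\
  forall q, capped_simplex n k q -> KLd n w what <= KLd n q what.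

Definition fixed_share_step (n : nat) (eta alpha : R) (w l : 'I_n -> R) : 'I_n -> R :=
  fun i => alpha / n%:R + (1 - alpha) *
    (w i * expR (- (eta * l i)) / \sum_j w j * expR (- (eta * l j))).

Definition corner_decomposition (n k : nat) (w : 'I_n -> R) (J : nat)
    (p : nat -> R) (r : nat -> 'I_n -> R) : Prop :=
  (forall j, (j < J)%N -> 0 <= p j /\ is_corner n k (r j)) /\
  \sum_(j < J) p j = 1 /\
  (forall i, \sum_(j < J) p j * r j i = w i).

Definition expected_loss (n k : nat) (J : nat) (p : nat -> R)
    (r : nat -> 'I_n -> R) (l : 'I_n -> R) : R :=
  \sum_(j < J) p j * dotv n (fun i => (n - k)%:R * r j i) l.

(* min_{q in B} sum_{t=a}^b (n-k) q^T l_t  (attained; written as an inf) *)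
Definition min_B_loss (n k : nat) (loss : nat -> 'I_n -> R) (a b : nat) : R :=
  inf [set x | exists q, capped_simplex n k q /\
               x = \sum_(a <= t < b.+1) (n - k)%:R * dotv n q (loss t)].

End Defs.
Arguments dotv {R}. Arguments capped_simplex {R}. Arguments is_corner {R}.
Arguments S_vec {R}. Arguments KLd {R}. Arguments is_KL_proj {R}.
Arguments fixed_share_step {R}. Arguments corner_decomposition {R}.
Arguments expected_loss {R}. Arguments min_B_loss {R}.

(* Main.v *)
Require Import Defs.
From HB Require Import structures.
From mathcomp Require Import all_boot all_order all_algebra.
From mathcomp Require Import all_classical all_reals all_analysis.
From mathcomp Require Import ring lra.
Import Order.TTheory GRing.Theory Num.Theory.
Local Open Scope ring_scope.

(** By the Pythagorean inequality for KL projections, projecting never increases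
    the divergence to a comparator [q], so one round of exponential weights
    followed by the uniform mixture raises [sum_i q_i ln S_(t,i)] ([S_t] the
    unprojected iterate) by at least
    [(1 - e^-eta) w_t.l_t - eta q.l_t + ln (1 - alpha)].  Mixing keeps
    [S_(t,i) >= alpha / n], so the potential ranges over an interval of length
    [ln (n / alpha)] and telescoping gives
    [(1 - e^-eta) A <= eta M + D] for the learner's loss [A] and the best fixed
    loss [M] on any interval, up to its first round, which costs at most
    [n - k <= 2 D].  The tuning of [eta] turns this into the regret bound. *)

(** * Elementary inequalities for [ln] and [expR] *)

Lemma ln_le_subr1 (R : realType) (x : R) : 0 < x -> ln x <= x - 1.
Proof. by move=> x0; have := expR_ge1Dx (ln x); rewrite lnK ?posrE //; lra. Qed.

(** Termwise Gibbs inequality, from [ln (b / a) <= b / a - 1]; summed over two probability vectors,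
    the left side cancels. *)
Lemma mul_ln_div_ge (R : realType) (a b : R) :
  0 <= a -> 0 <= b -> (0 < a -> 0 < b) -> a - b <= a * ln (a / b).
Proof.
rewrite le_eqVlt => /predU1P[<- b0 _|a0 b0 /(_ a0) b_gt0].
  by rewrite mul0r sub0r oppr_le0.
have := ln_le_subr1 _ _ (divr_gt0 b_gt0 a0).
rewrite -(ler_pM2l a0) mulrBr mulrCA divff ?gt_eqF // mulr1.
by rewrite -[b / a]invf_div lnV ?posrE ?divr_gt0 // mulrN; lra.
Qed.

(** Convexity: the tangent to the exponential at [- (eta * x)] lies below it at [0] and at [- eta];
    weighting these two bounds by [1 - x] and [x] cancels the slope. *)
Lemma expR_chord (R : realType) (eta x : R) : 0 <= x <= 1 ->
  expR (- (eta * x)) <= 1 - (1 - expR (- eta)) * x.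
Proof.
move=> /andP[x0 x1]; set e := expR (- (eta * x)).
have e0 : 0 < e := expR_gt0 _.
have h1 : e * (1 + eta * x) <= 1.
  by rewrite /e mulrC -ler_pdivlMr ?expR_gt0 // div1r -expRN opprK expR_ge1Dx.
have h2 : e * (1 + (- eta + eta * x)) <= expR (- eta).
  rewrite /e mulrC -ler_pdivlMr ?expR_gt0 // -expRN opprK -expRD.
  exact: expR_ge1Dx.
have h3 : (1 - x) * (e * (1 + eta * x)) <= (1 - x) * 1.
  by rewrite ler_wpM2l // subr_ge0.
have h4 := ler_wpM2l x0 h2.
have -> : e = (1 - x) * (e * (1 + eta * x)) + x * (e * (1 + (- eta + eta * x))).
  by ring.
lra.
Qed.

(** Stands in for the limit [s -> 0]: for negative [x], the value [- x / (1 + |c| - x)] of [s] is a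
    contradiction. *)
Lemma le_of_small_slack (R : realType) (x c : R) :
  (forall s, 0 < s < 1 -> 0 <= x + s * c) -> 0 <= x.
Proof.
move=> h; rewrite leNgt; apply/negP => x0.
have d0 : 0 < 1 + `|c| - x by have := normr_ge0 c; lra.
have s0 : 0 < (- x) / (1 + `|c| - x) by rewrite divr_gt0 // oppr_gt0.
have s1 : (- x) / (1 + `|c| - x) < 1.
  by rewrite ltr_pdivrMr //; have := normr_ge0 c; lra.
have := h _ (introT andP (conj s0 s1)).
set s := _ / _ in s0 s1 *.
have sd : s * (1 + `|c| - x) = - x by rewrite /s mulfVK ?gt_eqF.
have : s * c <= s * `|c| by rewrite ler_wpM2l ?ler_norm ?ltW.
have : s * x < 0 by rewrite pmulr_rlt0.
nra.
Qed.

(** * KL projection onto the capped simplex *)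

Section CappedSimplex.
Context {R : realType} {n k : nat}.
Implicit Types (w q S l u : 'I_n -> R) (s eta alpha : R).

Lemma capped_simplex_ge0 w i : capped_simplex n k w -> 0 <= w i.
Proof. by case=> _ /(_ i) /andP[]. Qed.

Lemma capped_simplex_le1 w i : capped_simplex n k w -> w i <= 1.
Proof.
move=> wB; have [<- _] := wB.
rewrite (bigD1 i) //= lerDl sumr_ge0 // => j _.
exact: capped_simplex_ge0 wB.
Qed.

Lemma capped_simplex_conv s w q : 0 <= s <= 1 ->
  capped_simplex n k w -> capped_simplex n k q ->
  capped_simplex n k (fun i => (1 - s) * w i + s * q i).
Proof.
move=> /andP[s0 s1] [w1 wb] [q1 qb]; split.
  by rewrite big_split /= -!mulr_sumr w1 q1 !mulr1 subrK.
move=> i; have /andP[w0 wc] := wb i; have /andP[q0 qc] := qb i.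
set c := _^-1 in wc qc *.
have : 0 <= 1 - s by lra.
move=> s1'; apply/andP; split; first by rewrite addr_ge0 ?mulr_ge0.
have := ler_wpM2l s1' wc; have := ler_wpM2l s0 qc; lra.
Qed.

(* Optimality of [w] is tested only at the interior points of the segment
   from [w] to [q], where every logarithm involved is finite. *)
Lemma KL_proj_segment w S q s : is_KL_proj n k w S ->
  (forall i, 0 < S i) -> \sum_i S i = 1 -> capped_simplex n k q ->
  0 < s < 1 ->
  0 <= \sum_i q i * ln (((1 - s) * w i + s * q i) / S i).
Proof.
move=> [wB wmin] S0 S1 qB /andP[s0 s1].
pose v i := (1 - s) * w i + s * q i.
have vB : capped_simplex n k v by apply: capped_simplex_conv => //; lra.
have w0 i := capped_simplex_ge0 w i wB.
have q0 i := capped_simplex_ge0 q i qB.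
have v0 i := capped_simplex_ge0 v i vB.
rewrite -[X in 0 <= X]/(\sum_i q i * ln (v i / S i)).
have vgt i : 0 < w i -> 0 < v i.
  by move=> wi; rewrite /v ltr_pwDl ?mulr_gt0 ?subr_gt0 // mulr_ge0 // ltW.
(* Gibbs bounds the left side by the divergence of [w] from [S], which optimality bounds by that of
   [v]. *)
have cmp : \sum_i w i * ln (v i / S i) <= \sum_i v i * ln (v i / S i).
  apply: le_trans (wmin v vB).
  have [w1 _] := wB; have [v1 _] := vB.
  have -> : \sum_i w i * ln (v i / S i) =
      \sum_i (w i * ln (v i / S i) + (w i - v i)).
    by rewrite big_split sumrB w1 v1 /= subrr addr0.
  apply: ler_sum => i _; have := w0 i; rewrite le_eqVlt => /predU1P[<-|wi].
    by rewrite !mul0r add0r sub0r oppr_le0.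
  have := mul_ln_div_ge _ _ _ (w0 i) (v0 i) (vgt i).
  rewrite !ln_div ?posrE ?vgt //; lra.
have vS : 0 <= \sum_i v i * ln (v i / S i).
  have [v1 _] := vB.
  rewrite -[X in X <= _](subrr 1) -{1}v1 -S1 -sumrB; apply: ler_sum => i _.
  exact: mul_ln_div_ge (v0 i) (ltW (S0 i)) (fun _ => S0 i).
move: cmp vS.
(* As [v] mixes [w] and [q], [cmp] says that the [w]-sum is at most its mixture with the [q]-sum,
   hence at most the [q]-sum. The mixture being nonnegative, so is the [q]-sum. *)
have -> : \sum_i v i * ln (v i / S i) = (1 - s) * \sum_i w i * ln (v i / S i)
    + s * \sum_i q i * ln (v i / S i).
  by rewrite !mulr_sumr -big_split; apply: eq_bigr => i _; rewrite /v /=; ring.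
move: (\sum_i w i * _) (\sum_i q i * _) => X Y.
move=> h1 h2; have : s * X <= s * Y by lra.
rewrite ler_pM2l // => XY.
have : (1 - s) * X <= (1 - s) * Y by rewrite ler_wpM2l //; lra.
lra.
Qed.

(** If [w i] were zero, moving from [w] towards [q] would contribute [q i * ln (s * q i)], unbounded
    below as [s -> 0], against [KL_proj_segment]. *)
Lemma KL_proj_gt0 w S q i : is_KL_proj n k w S ->
  (forall i, 0 < S i) -> \sum_i S i = 1 -> capped_simplex n k q ->
  0 < q i -> 0 < w i.
Proof.
move=> wP S0 S1 qB qi; have [wB _] := wP.
have wi0 := capped_simplex_ge0 w i wB.
rewrite lt_neqAle wi0 andbT; apply/negP => /eqP wi.
pose K := \sum_j q j * ln (S j).
have S_le1 j : S j <= 1.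
  by rewrite -S1 (bigD1 j) //= lerDl sumr_ge0 // => h _; exact: ltW.
have K0 : K <= 0.
  rewrite /K sumr_le0 // => j _.
  by rewrite mulr_ge0_le0 ?(capped_simplex_ge0 q j qB) // ln_le0.
(* Chosen so that [q i * ln s = K - q i], which leaves the whole sum at most [- q i]; [K <= 0]
   ensures [s < 1]. *)
pose s := expR (K / q i - 1).
have s1 : s < 1.
  by rewrite expR_lt1 subr_lt0 (le_lt_trans _ ltr01) // pmulr_lle0 ?invr_gt0.
have s01 : 0 < s < 1 by rewrite expR_gt0.
have := KL_proj_segment _ _ _ _ wP S0 S1 qB s01.
pose v j := (1 - s) * w j + s * q j.
have vB : capped_simplex n k v by apply: capped_simplex_conv => //; lra.
rewrite -[X in 0 <= X]/(\sum_j q j * ln (v j / S j)); apply/negP; rewrite -ltNge.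
have -> : \sum_j q j * ln (v j / S j) = \sum_j q j * ln (v j) - K.
  rewrite /K -sumrB; apply: eq_bigr => j _.
  have := capped_simplex_ge0 q j qB; rewrite le_eqVlt => /predU1P[<-|qj].
    by rewrite !mul0r subr0.
  have vj : 0 < v j.
    rewrite /v ltr_wpDl ?mulr_gt0 ?mulr_ge0 ?(capped_simplex_ge0 w j wB) //;
    by case/andP: s01 => //; lra.
  by rewrite ln_div ?posrE // mulrBr.
rewrite (bigD1 i) //=.
have : \sum_(j | j != i) q j * ln (v j) <= 0.
  rewrite sumr_le0 // => j _.
  by rewrite mulr_ge0_le0 ?(capped_simplex_ge0 q j qB) ?ln_le0
    ?(capped_simplex_le1 v j vB).
have -> : v i = s * q i by rewrite /v -wi mulr0 add0r.
rewrite lnM ?posrE // ?expR_gt0 // expRK mulrDr mulrBr mulrCA divff ?gt_eqF //.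
have : q i * ln (q i) <= 0.
  by rewrite mulr_ge0_le0 ?(ltW qi) ?ln_le0 ?(capped_simplex_le1 q i qB).
rewrite !mulr1; lra.
Qed.

(** The Pythagorean inequality [d(q, w) <= d(q, S)], written as one sum. It follows from
    [KL_proj_segment] as [s -> 0], because [ln (v / w) <= s * (q - w) / w] at the point [v] of the
    segment. *)
Lemma KL_proj_ln_ge0 w S q : is_KL_proj n k w S ->
  (forall i, 0 < S i) -> \sum_i S i = 1 -> capped_simplex n k q ->
  0 <= \sum_i q i * ln (w i / S i).
Proof.
move=> wP S0 S1 qB; have [wB _] := wP.
apply: (le_of_small_slack _ _ (\sum_i q i * ((q i - w i) / w i))) => s s01.
apply: le_trans (KL_proj_segment _ _ _ _ wP S0 S1 qB s01) _.
rewrite mulr_sumr -big_split; apply: ler_sum => i _ /=.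
have := capped_simplex_ge0 q i qB; rewrite le_eqVlt => /predU1P[<-|qi].
  by rewrite !mul0r mulr0 addr0.
have wi := KL_proj_gt0 _ _ _ _ wP S0 S1 qB qi.
rewrite mulrCA -mulrDr ler_pM2l //.
have /andP[s0 s1] := s01.
have v0 : 0 < (1 - s) * w i + s * q i.
  by rewrite ltr_wpDl ?mulr_gt0 // mulr_ge0 ?ltW // subr_gt0.
have := ln_le_subr1 _ _ (divr_gt0 v0 wi).
rewrite !ln_div ?posrE //.
have -> : ((1 - s) * w i + s * q i) / w i - 1 = s * ((q i - w i) / w i).
  by field; rewrite gt_eqF.
lra.
Qed.

(** * One fixed-share step *)

Lemma normalizer_gt0 eta w l : capped_simplex n k w ->
  0 < \sum_j w j * expR (- (eta * l j)).
Proof.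
move=> wB; have [w1 _] := wB.
have w0 i := capped_simplex_ge0 w i wB.
rewrite lt_neqAle sumr_ge0 ?andbT => [|i _]; last by rewrite mulr_ge0 ?expR_ge0.
apply/negP => /eqP/esym/eqP; rewrite psumr_eq0 => [|i _]; last first.
  by rewrite mulr_ge0 ?expR_ge0.
move=> /allP h; have : \sum_i w i = 0.
  apply: big1 => i _; have := h i (mem_index_enum i).
  by rewrite mulf_eq0 (gt_eqF (expR_gt0 _)) orbF => /eqP.
by rewrite w1 => /eqP; rewrite oner_eq0.
Qed.

Lemma capped_simplex_size_gt0 w : capped_simplex n k w -> (0 < n)%N.
Proof.
case: n w => [|//] w [w1 _]; move: w1; rewrite big_ord0 => /eqP.
by rewrite eq_sym oner_eq0.
Qed.

Lemma fixed_share_ge_share eta alpha w l i : alpha <= 1 ->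
  capped_simplex n k w -> alpha / n%:R <= fixed_share_step n eta alpha w l i.
Proof.
move=> a1 wB; rewrite /fixed_share_step lerDl mulr_ge0 ?subr_ge0 //.
by rewrite divr_ge0 ?(ltW (normalizer_gt0 _ _ _ wB)) ?mulr_ge0
  ?(capped_simplex_ge0 w i wB) ?expR_ge0.
Qed.

Lemma fixed_share_sum eta alpha w l :
  capped_simplex n k w -> \sum_i fixed_share_step n eta alpha w l i = 1.
Proof.
move=> wB; rewrite /fixed_share_step big_split /= sumr_const card_ord.
rewrite -mulr_sumr -mulr_suml divff ?gt_eqF ?(normalizer_gt0 _ _ _ wB) // mulr1.
rewrite -[X in X + _]mulr_natr mulfVK; first by rewrite addrC subrK.
by rewrite pnatr_eq0 -lt0n (capped_simplex_size_gt0 _ wB).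
Qed.

(** The chord bound gives [ln Z <= - (1 - expR (- eta)) * dotv n w l] for the normalizer [Z], and
    discarding the uniform share [alpha / n] costs only [ln (1 - alpha)]. *)
Lemma fixed_share_progress eta alpha w q l : 0 < alpha < 1 ->
  capped_simplex n k w -> capped_simplex n k q ->
  (forall i, 0 <= l i <= 1) -> (forall i, 0 < q i -> 0 < w i) ->
  ln (1 - alpha) - eta * dotv n q l + (1 - expR (- eta)) * dotv n w l
  <= \sum_i q i * ln (fixed_share_step n eta alpha w l i / w i).
Proof.
move=> /andP[a0 a1] wB qB l01 supp; have [w1 _] := wB; have [q1 _] := qB.
set Z := \sum_j w j * expR (- (eta * l j)).
have Z0 : 0 < Z := normalizer_gt0 _ _ _ wB.
have ZE : Z <= 1 - (1 - expR (- eta)) * dotv n w l.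
  rewrite -{1}w1 /dotv mulr_sumr -sumrB; apply: ler_sum => i _.
  have := ler_wpM2l (capped_simplex_ge0 w i wB) (expR_chord _ eta _ (l01 i)).
  lra.
have lnZ := ln_le_subr1 _ _ Z0.
apply: (@le_trans _ _ (\sum_i q i * (ln (1 - alpha) - eta * l i - ln Z))).
  have -> : \sum_i q i * (ln (1 - alpha) - eta * l i - ln Z)
      = (\sum_i q i) * (ln (1 - alpha) - ln Z) - eta * dotv n q l.
    rewrite /dotv mulr_suml mulr_sumr -sumrB; apply: eq_bigr => i _; ring.
  by rewrite q1; lra.
apply: ler_sum => i _.
have := capped_simplex_ge0 q i qB; rewrite le_eqVlt => /predU1P[<-|qi].
  by rewrite !mul0r.
have wi := supp _ qi; rewrite ler_pM2l //.
have a1' : 0 < 1 - alpha by rewrite subr_gt0.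
have x0 : 0 < (1 - alpha) * (w i * expR (- (eta * l i)) / Z) / w i.
  by rewrite !(divr_gt0, mulr_gt0) ?expR_gt0.
have -> : ln (1 - alpha) - eta * l i - ln Z =
    ln ((1 - alpha) * (w i * expR (- (eta * l i)) / Z) / w i).
  have -> : (1 - alpha) * (w i * expR (- (eta * l i)) / Z) / w i =
      (1 - alpha) * expR (- (eta * l i)) / Z by field; rewrite !gt_eqF.
  by rewrite ln_div ?posrE ?mulr_gt0 ?expR_gt0 // lnM ?posrE ?expR_gt0 // expRK.
rewrite ler_ln ?posrE //.
  by rewrite ler_pM2r ?invr_gt0 // /fixed_share_step lerDr divr_ge0 ?ler0n ?ltW.
apply: lt_le_trans x0 _.
by rewrite ler_pM2r ?invr_gt0 // /fixed_share_step lerDr divr_ge0 ?ler0n ?ltW.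
Qed.

(** * Expected losses and subset comparators *)

Lemma expected_lossE w (J : nat) (p : nat -> R) (r : nat -> 'I_n -> R) l :
  corner_decomposition n k w J p r ->
  expected_loss n k J p r l = (n - k)%:R * dotv n w l.
Proof.
move=> [_ [_ wE]]; rewrite /expected_loss /dotv mulr_sumr.
under eq_bigr do rewrite mulr_sumr.
rewrite exchange_big; apply: eq_bigr => i _ /=.
rewrite -wE mulr_suml mulr_sumr; apply: eq_bigr => j _; ring.
Qed.

Lemma dotv_ge0 q l : (forall i, 0 <= q i) -> (forall i, 0 <= l i) ->
  0 <= dotv n q l.
Proof. by move=> q0 l0; rewrite sumr_ge0 // => i _; rewrite mulr_ge0. Qed.

Lemma dotv_capped_le1 q l : capped_simplex n k q ->
  (forall i, l i <= 1) -> dotv n q l <= 1.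
Proof.
move=> qB l1; have [<- _] := qB; apply: ler_sum => i _.
by rewrite ler_piMr // (capped_simplex_ge0 q i qB).
Qed.

(** Places each subset comparator, rescaled, among the competitors of the infimum [min_B_loss]. *)
Lemma S_vec_capped u : (k < n)%N -> S_vec n k u ->
  capped_simplex n k (fun i => u i / (n - k)%:R).
Proof.
move=> kn [u01 uc].
have m0 : 0 < (n - k)%:R :> R by rewrite ltr0n subn_gt0.
split; last first.
  by move=> i; have [->|->] := u01 i;
    rewrite ?mul0r ?mul1r lexx invr_ge0 (ltW m0).
rewrite -mulr_suml.
suff -> : \sum_i u i = (n - k)%:R by rewrite divff ?gt_eqF.
rewrite -uc -sum1_card natr_sum [RHS]big_mkcond; apply: eq_bigr => i _.
have -> : (i \in [set i | u i == 1]%classic) = (u i == 1).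
  by apply/idP/idP; rewrite in_setE.
by have [->|->] := u01 i; rewrite ?eqxx // eq_sym oner_eq0.
Qed.

(** * Accumulated loss over an interval *)

Lemma fixed_share_trajectory_capped T eta alpha (loss w : nat -> 'I_n -> R) :
  capped_simplex n k (w 1%N) ->
  (forall t, (1 <= t < T)%N ->
     is_KL_proj n k (w t.+1) (fixed_share_step n eta alpha (w t) (loss t))) ->
  forall t, (1 <= t <= T)%N -> capped_simplex n k (w t).
Proof.
by move=> w1B wP [|[|t]] //= tT; have [] := wP t.+1 tT.
Qed.

(* The potential is [sum_i q_i ln S_(t,i)], with [S_t] the unprojected iterate.
   It is finite only from [t = 2] on, because [w_1] may have zero entries;
   hence the first round of every interval is left out. *)
Lemma fixed_share_interval T eta alpha (loss w : nat -> 'I_n -> R) q a b :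
  0 < alpha < 1 ->
  (forall t i, (1 <= t <= T)%N -> 0 <= loss t i <= 1) ->
  capped_simplex n k (w 1%N) ->
  (forall t, (1 <= t < T)%N ->
     is_KL_proj n k (w t.+1) (fixed_share_step n eta alpha (w t) (loss t))) ->
  (1 <= a)%N -> (a <= b)%N -> (b <= T)%N -> capped_simplex n k q ->
  (1 - expR (- eta)) * \sum_(a.+1 <= t < b.+1) dotv n (w t) (loss t)
  <= eta * \sum_(a.+1 <= t < b.+1) dotv n q (loss t)
     - (b - a)%:R * ln (1 - alpha) - ln (alpha / n%:R).
Proof.
move=> a01 l01 w1B wP a1 ab bT qB.
have wB := fixed_share_trajectory_capped _ _ _ _ _ w1B wP.
have [q1 _] := qB; have /andP[al0 al1] := a01.
have n0 : 0 < n%:R :> R by rewrite ltr0n (capped_simplex_size_gt0 _ qB).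
(* Shifted so that [w t] is the projection of [S t] for [2 <= t <= T]; [S T.+1] still makes sense,
   though it is never projected. *)
pose S t := fixed_share_step n eta alpha (w t.-1) (loss t.-1).
have S_ge t i : (2 <= t <= T.+1)%N -> alpha / n%:R <= S t i.
  case: t => [|t] //= tT; apply: fixed_share_ge_share; first exact: ltW.
  exact: wB.
have S_gt0 t i : (2 <= t <= T.+1)%N -> 0 < S t i.
  by move=> tT; apply: lt_le_trans (S_ge _ _ tT); rewrite divr_gt0.
have S_sum t : (2 <= t <= T.+1)%N -> \sum_i S t i = 1.
  by case: t => [|t] //= tT; apply: fixed_share_sum; exact: wB.
pose P t := \sum_i q i * ln (S t i).
have PE t : (a.+1 <= t < b.+1)%N ->
    (1 - expR (- eta)) * dotv n (w t) (loss t)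
    <= eta * dotv n q (loss t) - ln (1 - alpha) + (P t.+1 - P t).
  move=> /andP[at_ tb].
  have t2 : (2 <= t)%N by exact: leq_ltn_trans a1 at_.
  have tT : (t <= T)%N by rewrite ltnS in tb; exact: leq_trans tb bT.
  have tT1 : (2 <= t <= T.+1)%N by rewrite t2 leqW.
  have tT2 : (2 <= t.+1 <= T.+1)%N by rewrite !ltnS (ltnW t2).
  have t1T : (1 <= t <= T)%N by rewrite (ltnW t2).
  have wS : is_KL_proj n k (w t) (S t).
    by move: t2 tT; rewrite /S; case: (t) => [|u] //= u1 uT; apply: wP; rewrite -ltnS u1.
  have S0 i := S_gt0 t i tT1; have S1 := S_sum t tT1.
  have supp i := KL_proj_gt0 _ _ _ i wS S0 S1 qB.
  have h1 := KL_proj_ln_ge0 _ _ _ wS S0 S1 qB.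
  have h2 := fixed_share_progress eta alpha _ _ _ a01 (wB _ t1T) qB
    (fun i => l01 t i t1T) supp.
  (* The increment is split at [w t]: the step from [w t] to [S t.+1] gains by [h2], and the
     projection of [S t] to [w t] loses nothing by [h1]. *)
  have h3 : P t.+1 - P t = \sum_i q i * ln (S t.+1 i / w t i)
      + \sum_i q i * ln (w t i / S t i).
    rewrite /P -sumrB -big_split; apply: eq_bigr => i _ /=.
    have := capped_simplex_ge0 q i qB; rewrite le_eqVlt => /predU1P[<-|qi].
      by rewrite !mul0r subrr addr0.
    have wi := supp _ qi; have Si := S_gt0 _ i tT2; have Si' := S0 i.
    by rewrite !ln_div ?posrE //; ring.
  by rewrite h3; move: h2; rewrite -/(S t.+1); lra.
have : (1 - expR (- eta)) * \sum_(a.+1 <= t < b.+1) dotv n (w t) (loss t) <=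
    \sum_(a.+1 <= t < b.+1)
      (eta * dotv n q (loss t) - ln (1 - alpha) + (P t.+1 - P t)).
  by rewrite mulr_sumr; apply: ler_sum_nat.
rewrite big_split telescope_sumr ?ltnS // sumrB -mulr_sumr sumr_const_nat subSS.
move=> /le_trans; apply; rewrite -[in X in _ - X + _ <= _]mulr_natl /=.
have Pb : P b.+1 <= 0.
  have b2 : (2 <= b.+1 <= T.+1)%N by rewrite !ltnS (leq_trans a1 ab) bT.
  rewrite /P sumr_le0 // => i _.
  rewrite mulr_ge0_le0 ?(capped_simplex_ge0 q i qB) ?ln_le0 //.
  rewrite -(S_sum _ b2) (bigD1 i) //= lerDl sumr_ge0 // => j _.
  exact: ltW (S_gt0 _ _ b2).
have Pa : ln (alpha / n%:R) <= P a.+1.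
  have a2 : (2 <= a.+1 <= T.+1)%N by rewrite !ltnS a1 (leq_trans ab bT).
  rewrite -[X in X <= _]mul1r -{1}q1 mulr_suml; apply: ler_sum => i _.
  rewrite ler_wpM2l ?(capped_simplex_ge0 q i qB) //.
  by rewrite ler_ln ?posrE ?divr_gt0 ?S_gt0 ?S_ge.
lra.
Qed.
End CappedSimplex.

(* With [e^eta = 1 + x] the factor [1 - e^-eta] is [x / (1 + x)] and
   [eta <= x]; the choice of [x] balances [L x] against [D / x]. *)
Lemma tuned_regret_le {R : realType} (A M L D : R) :
  0 < D -> 0 < L -> 0 <= M -> M <= L ->
  let eta := ln (1 + Num.sqrt (2 * D / L)) in
  (1 - expR (- eta)) * A <= eta * M + D ->
  A - M <= 2 * Num.sqrt (2 * L * D) + D.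
Proof.
move=> D0 L0 M0 ML /=; set x := Num.sqrt (2 * D / L).
have DL0 : 0 < 2 * D / L by rewrite divr_gt0 ?mulr_gt0.
have x0 : 0 < x by rewrite sqrtr_gt0.
have x1 : 0 < 1 + x by lra.
have xx : x * x * L = 2 * D.
  by rewrite -expr2 sqr_sqrtr ?ltW // mulfVK ?gt_eqF.
have -> : Num.sqrt (2 * L * D) = L * x.
  have -> : 2 * L * D = (L * x) ^+ 2 by rewrite expr2; nra.
  by rewrite sqrtr_sqr ger0_norm // mulr_ge0 // ltW.
rewrite expRN lnK ?posrE // => h.
have lx : ln (1 + x) <= x by have := ln_le_subr1 _ _ x1; lra.
have h1 : x * A <= (1 + x) * (x * M + D).
  have -> : x * A = (1 + x) * ((1 - (1 + x)^-1) * A) by field; rewrite gt_eqF.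
  rewrite ler_pM2l //; apply: le_trans h _; rewrite lerD2r ler_wpM2r //.
rewrite -(ler_pM2l x0).
(* Since [D = x * x * L / 2], the excess [x * x * M + D + x * D] is at most
   [3 / 2 * x * x * L + x * D], within the target multiplied by [x]. *)
have : x * x * M <= x * x * L by rewrite ler_wpM2l // mulr_ge0 // ltW.
nra.
Qed.

(** The maximum over intervals and the minimum over [S_vec] appear as universal quantifiers; [C]
    precedes all data, hence is absolute. *)
Theorem theorem4p1 :
  exists C : nat,
  forall (R : realType) (n k T : nat),
  (1 <= k)%N -> (k < n)%N -> (1 <= T)%N ->
  forall (loss : nat -> 'I_n -> R) (w : nat -> 'I_n -> R)
         (J : nat -> nat) (p : nat -> nat -> R) (r : nat -> nat -> 'I_n -> R)
         (L : R),
  let m : R := (n - k)%:R in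
  let alpha : R := (T%:R * m + 1)^-1 in
  let D : R := m * ln (n%:R * (1 + m * T%:R)) + 1 in
  let eta : R := ln (1 + Num.sqrt (2 * D / L)) in
  (* losses l_t in [0,1]^n *)
  (forall t i, (1 <= t <= T)%N -> 0 <= loss t i <= 1) ->
  (* w_1 in B *)
  capped_simplex n k (w 1%N) ->
  (* w_{t+1} = argmin_{w in B} d(w, hat w_{t+1}) *)
  (forall t, (1 <= t < T)%N ->
     is_KL_proj n k (w t.+1) (fixed_share_step n eta alpha (w t) (loss t))) ->
  (* sampling: w_t = sum_j p_j r_j over corners r_j *)
  (forall t, (1 <= t <= T)%N -> corner_decomposition n k (w t) (J t) (p t) (r t)) ->
  0 < L ->
  (forall a b, (1 <= a)%N -> (a <= b)%N -> (b <= T)%N -> min_B_loss n k loss a b <= L) ->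
  forall a b, (1 <= a)%N -> (a <= b)%N -> (b <= T)%N ->
  forall u : 'I_n -> R, S_vec n k u ->
    \sum_(a <= t < b.+1) expected_loss n k (J t) (p t) (r t) (loss t)
    - \sum_(a <= t < b.+1) dotv n u (loss t)
    <= C%:R * (Num.sqrt (2 * L * D) + D).
Proof.
(* Tuning gives [2 * sqrt + D], and the skipped first round adds [m <= 2 * D]. *)
exists 3%N => R n k T k1 kn T1 loss w J p r L m alpha D eta.
move=> l01 w1B wP dec L0 minL a b a1 ab bT u uS.
have m1 : 1 <= m by rewrite ler1n subn_gt0.
have m0 : 0 < m by lra.
have Tr1 : 1 <= T%:R :> R by rewrite ler1n.
have Tm1 : 1 <= T%:R * m by rewrite -[X in X <= _]mulr1 ler_pM.
have n2 : 2 <= n%:R :> R by rewrite ler_nat (leq_ltn_trans k1 kn).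
have a01 : 0 < alpha < 1.
  have Tm0 : 0 < T%:R * m + 1 by lra.
  by rewrite /alpha invr_gt0 invf_lt1 // Tm0 ltrDr; lra.
(* [N] equals [n / alpha], so [ln N] is the length of the potential's range. *)
pose N := n%:R * (1 + m * T%:R).
have N4 : 4 <= N.
  rewrite /N; have -> : 4 = 2 * 2 :> R by lra.
  by rewrite ler_pM //; lra.
have N0 : 0 < N by lra.
have lnN : 1 / 2 <= ln N.
  have Ni : N^-1 <= 1 / 2 by rewrite div1r lef_pV2 ?posrE //; lra.
  have := ln_le_subr1 _ N^-1; rewrite invr_gt0 lnV ?posrE // => /(_ N0); lra.
have mD : m <= 2 * D by rewrite /D -/N; nra.
have D0 : 0 < D by lra.
have aN : - ln (alpha / n%:R) = ln N.
  have -> : alpha / n%:R = N^-1.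
    by rewrite /alpha /N -invfM; congr (_^-1); ring.
  by rewrite lnV ?posrE // opprK.
(* The total cost of mixing, scaled by [m]: this is the [+ 1] in [D]. *)
have a_share : - (T%:R * m * ln (1 - alpha)) <= 1.
  have Tm0 : 0 < T%:R * m by lra.
  have -> : 1 - alpha = (1 + (T%:R * m)^-1)^-1.
    by rewrite /alpha; field; rewrite !gt_eqF //; lra.
  have i0 : 0 < 1 + (T%:R * m)^-1 by rewrite addr_gt0 ?invr_gt0.
  have := ln_le_subr1 _ _ i0; rewrite [X in _ <= X - 1]addrC addrK.
  by rewrite -(ler_pM2l Tm0) divff ?gt_eqF // lnV ?posrE // mulrN opprK.
have wB := fixed_share_trajectory_capped _ _ _ _ _ w1B wP.
have range t : (a <= t < b.+1)%N -> (1 <= t <= T)%N.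
  by rewrite ltnS => /andP[at_ tb]; rewrite (leq_trans a1 at_) (leq_trans tb bT).
have range1 t : (a.+1 <= t < b.+1)%N -> (1 <= t <= T)%N.
  by move=> /andP[at_ tb]; rewrite range // (ltnW at_) tb.
have l0 t : (a <= t < b.+1)%N -> forall i, 0 <= loss t i.
  by move=> /range tT i; have /andP[] := l01 t i tT.
pose M q := \sum_(a <= t < b.+1) m * dotv n q (loss t).
have M0 q : capped_simplex n k q -> 0 <= M q.
  move=> qB; rewrite /M big_nat_cond sumr_ge0 // => t /andP[tab _].
  apply: mulr_ge0 (ltW m0) (dotv_ge0 _ _ _ (l0 _ tab)) => i.
  exact: capped_simplex_ge0 qB.
set A := \sum_(a <= t < b.+1) expected_loss _ _ _ _ _ _.
have AE : A = \sum_(a <= t < b.+1) m * dotv n (w t) (loss t).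
  by apply: eq_big_nat => t /range tT; apply: expected_lossE; exact: dec.
have aab : (a <= a < b.+1)%N by rewrite leqnn ltnS.
have key q : capped_simplex n k q ->
    (1 - expR (- eta)) * (A - m) <= eta * M q + D.
  move=> qB; have := fixed_share_interval _ eta _ _ _ _ _ _ a01 l01 w1B wP a1 ab bT qB.
  set W := \sum_(_ <= t < _) dotv n (w t) _.
  set Q := \sum_(_ <= t < _) dotv n q _ => h.
  have eta0 : 0 <= eta by rewrite ln_ge0 // lerDl sqrtr_ge0.
  have Am : A - m <= m * W.
    rewrite AE big_ltn // -mulr_sumr -/W.
    have : m * dotv n (w a) (loss a) <= m * 1.
      rewrite ler_pM2l //; apply: dotv_capped_le1 (wB _ (range _ aab)) _ => i.
      by have /andP[] := l01 a i (range _ aab).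
    lra.
  have MQ : m * Q <= M q.
    rewrite /M big_ltn // -mulr_sumr -/Q lerDr.
    apply: mulr_ge0 (ltW m0) (dotv_ge0 _ _ _ (l0 _ aab)) => i.
    exact: capped_simplex_ge0 qB.
  have c0 : 0 <= 1 - expR (- eta) by rewrite subr_ge0 expR_le1 oppr_le0.
  have h1 := ler_wpM2l c0 Am; have h2 := ler_wpM2l eta0 MQ.
  have h3 := ler_wpM2l (ltW m0) h.
  have la : ln (1 - alpha) <= 0 by rewrite ln_le0 // gerBl; lra.
  have h4 : - ((b - a)%:R * ln (1 - alpha)) <= - (T%:R * ln (1 - alpha)).
    by rewrite lerN2 ler_wnM2r // ler_nat (leq_trans (leq_subr _ _)).
  have h5 := ler_wpM2l (ltW m0) h4.
  rewrite /D -/N -aN; lra.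
(* The bound [L] constrains only the infimum, so tuning is applied to [I], and [u] enters afterwards
   through [I <= u]'s loss. Strict positivity of [eta] lets [key] pass to the infimum by
   division. *)
pose I := min_B_loss n k loss a b.
have keyI : (1 - expR (- eta)) * (A - m) <= eta * I + D.
  have eta0 : 0 < eta.
    by rewrite ln_gt0 // ltrDl sqrtr_gt0 divr_gt0 ?mulr_gt0.
  rewrite -lerBlDr [eta * I]mulrC -ler_pdivrMr //; apply: lb_le_inf.
    by exists (M (w 1%N)), (w 1%N).
  move=> _ [q [qB ->]]; rewrite -/(M q).
  by rewrite ler_pdivrMr // lerBlDr [M q * _]mulrC key.
have I0 : 0 <= I.
  apply: lb_le_inf; first by exists (M (w 1%N)), (w 1%N).
  by move=> _ [q [qB ->]]; exact: M0.
have IU : I <= \sum_(a <= t < b.+1) dotv n u (loss t).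
  apply: ge_inf.
    by exists 0 => _ [q [qB ->]]; exact: M0.
  exists (fun i => u i / m); split; first exact: S_vec_capped.
  apply: eq_bigr => t _; rewrite /dotv mulr_sumr; apply: eq_bigr => i _.
  by rewrite -/m; field; rewrite gt_eqF.
have := tuned_regret_le _ _ _ _ D0 L0 I0 (minL _ _ a1 ab bT) keyI.
have := sqrtr_ge0 (2 * L * D); lra.
Qed.
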